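(* Let $K\subseteq\mathbb{R}^n$ be a nonempty closed convex cone, $b\in\mathbb{R}^m$, and let $A\in\mathbb{R}^{m\times n}$ have full rank with $m\le n$. Let $T_2$ be the operator defined in the context, let $z^0\in\mathbb{R}^n$ be any starting point, and consider the iteration $z^{k+1}=T_2(z^k)$, $k=0,1,\dots$, with $x^{k+1/2}=P_K(z^k)$. Then: 1. (P) is feasible if and only if $z^k$ converges; in this case $x^{k+1/2}$ converges to a feasible point of (P). 2. (P) is infeasible if and only if $z^k$ diverges in that $\|z^k\|\to\infty$.
   Context: A set $K\subseteq\mathbb{R}^n$ is a cone if $K=\lambda K$ for every $\lambda>0$. $\|\cdot\|$ is the Euclidean norm. (P) is the problem: minimize $c^Tx$ subject to $Ax=b$, $x\in K$ (for some $c\in\mathbb{R}^n$). It is feasible if $K\cap\{x\mid Ax=b\}\ne\emptyset$, infeasible otherwise; a feasible point is an element of $K\cap\{x\mid Ax=b\}$. For a nonempty closed convex set $C$, $P_C$ is the Euclidean projection onto $C$ and $R_C(x)=2P_C(x)-x$. $\mathcal{N}(A)$ is the null space of $A$. Define $\tilde T(z)=\frac12\left(z+R_{\mathcal{N}(A)}(R_K(z))\right)$, $x_0=A^T(AA^T)^{-1}b$, and $T_2(z)=\tilde T(z)+x_0$. *)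

(* Defs.v *)
From HB Require Import structures.
From mathcomp Require Import all_boot all_order all_algebra.
From mathcomp Require Import all_classical all_reals all_analysis.

Set Implicit Arguments.
Unset Strict Implicit.
Unset Printing Implicit Defensive.

Import Order.TTheory GRing.Theory Num.Theory.
Import numFieldNormedType.Exports.

Local Open Scope classical_set_scope.
Local Open Scope ring_scope.

(* The library norm on matrices is the max norm; it induces the usual topology
   on 'cV[R]_n, but projections must be taken for the Euclidean norm. *)
Definition enorm (R : realType) (n : nat) (x : 'cV[R]_n) : R :=
  Num.sqrt (\sum_(i < n) x i 0 ^+ 2).

Definition is_cone (R : realType) (n : nat) (K : set 'cV[R]_n) : Prop :=
  forall l : R, 0 < l -> K = [set l *: x | x in K].

Definition feasible_set (R : realType) (m n : nat) (A : 'M[R]_(m, n))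
    (b : 'cV[R]_m) (K : set 'cV[R]_n) : set 'cV[R]_n :=
  K `&` [set x | A *m x = b].

Definition feasible (R : realType) (m n : nat) (A : 'M[R]_(m, n))
    (b : 'cV[R]_m) (K : set 'cV[R]_n) : Prop :=
  feasible_set A b K !=set0.

Definition nearest_points (R : realType) (n : nat) (C : set 'cV[R]_n)
    (x : 'cV[R]_n) : set 'cV[R]_n :=
  [set p | C p /\ forall y, C y -> enorm (x - p) <= enorm (x - y)].

(* For C nonempty, closed and convex, [nearest_points C x] is a singleton, so
   the default value 0 is irrelevant. *)
Definition eproj (R : realType) (n : nat) (C : set 'cV[R]_n) (x : 'cV[R]_n) :
    'cV[R]_n :=
  xget 0 (nearest_points C x).

Definition ereflect (R : realType) (n : nat) (C : set 'cV[R]_n) (x : 'cV[R]_n) :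
    'cV[R]_n :=
  2%:R *: eproj C x - x.

Definition null_space (R : realType) (m n : nat) (A : 'M[R]_(m, n)) :
    set 'cV[R]_n :=
  [set x | A *m x = 0].

Definition Ttilde (R : realType) (m n : nat) (A : 'M[R]_(m, n))
    (K : set 'cV[R]_n) (z : 'cV[R]_n) : 'cV[R]_n :=
  2%:R^-1 *: (z + ereflect (null_space A) (ereflect K z)).

(* [invmx] is a genuine inverse here as soon as A has full row rank. *)
Definition offset (R : realType) (m n : nat) (A : 'M[R]_(m, n)) (b : 'cV[R]_m) :
    'cV[R]_n :=
  A^T *m invmx (A *m A^T) *m b.

Definition T2 (R : realType) (m n : nat) (A : 'M[R]_(m, n)) (b : 'cV[R]_m)
    (K : set 'cV[R]_n) (z : 'cV[R]_n) : 'cV[R]_n :=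
  Ttilde A K z + offset A b.

(* Main.v *)
Require Import Defs.
From mathcomp Require Import all_boot all_order all_algebra.
From mathcomp Require Import all_classical all_reals all_analysis.
From mathcomp Require Import ring lra.

Import Order.TTheory GRing.Theory Num.Theory.
Import numFieldNormedType.Exports.

Local Open Scope classical_set_scope.
Local Open Scope ring_scope.

(** Both projections are onto closed convex sets, so the two reflections are
    nonexpansive and [T2] is the average of the identity and a nonexpansive
    map, up to a translation: it is firmly nonexpansive
    ([T2_firmly_nonexpansive]).  Rewriting one step as
      [T2 z = z - P_K z + P_N (R_K z) + x0]
    links its fixed points to (P): every fixed point projects on K to a
    feasible point, because [A] kills [P_N] and maps [x0] to [b]
    ([T2_fixed_feasible]); and every feasible [x] is itself fixed, because
    [P_K x = x] and [P_N x = x - x0] ([feasible_T2_fixed]).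

    What remains is a dichotomy for the orbits of any firmly nonexpansive [T]
    of a Euclidean space ([orbit_cvg_or_dvg]): either the orbit converges to a
    fixed point, or its norm tends to infinity.  If the norm does not tend to
    infinity, the orbit visits some ball infinitely often, hence has a cluster
    point [p] by compactness.  The length of the displacement [x - T x] does not
    increase along the orbit, so it takes the same value at [p] and at [T p];
    the equality case of firm nonexpansiveness then makes the displacement
    vectors themselves equal, and by iteration [T^k p = p - k v] with
    [v = p - T p].  The orbit stays at bounded distance from [T^k p] and comes
    back near [p] infinitely often, so [v = 0] and [p] is fixed
    ([cluster_fixed]).  Distances to a fixed point do not increase, so the whole
    orbit converges to [p] ([cluster_cvg]).

    If (P) is feasible, the orbit stays at bounded distance from a fixed point,
    so it converges; the projection on K is continuous, so the projected
    iterates converge to a feasible point.  If (P) is infeasible, there is no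
    fixed point, so the norm tends to infinity.  *)

(** * Euclidean inner product and norm *)

Definition edot {R : realType} {n : nat} (x y : 'cV[R]_n) : R :=
  \sum_(i < n) x i 0 * y i 0.

Section InnerProduct.
Context {R : realType} {n : nat}.
Implicit Types (x y : 'cV[R]_n) (a : R).

Lemma edotC x y : edot x y = edot y x.
Proof. by apply: eq_bigr => i _; rewrite mulrC. Qed.

Lemma edotDl x1 x2 y : edot (x1 + x2) y = edot x1 y + edot x2 y.
Proof. by rewrite -big_split; apply: eq_bigr => i _ /=; rewrite mxE mulrDl. Qed.

Lemma edotZl a x y : edot (a *: x) y = a * edot x y.
Proof.
by rewrite /edot big_distrr; apply: eq_bigr => i _ /=; rewrite mxE mulrA.
Qed.

Lemma edotNl x y : edot (- x) y = - edot x y.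
Proof. by rewrite -scaleN1r edotZl mulN1r. Qed.

Lemma edotDr x y1 y2 : edot x (y1 + y2) = edot x y1 + edot x y2.
Proof. by rewrite edotC edotDl !(edotC x). Qed.

Lemma edotZr a x y : edot x (a *: y) = a * edot x y.
Proof. by rewrite edotC edotZl (edotC x). Qed.

Lemma edotNr x y : edot x (- y) = - edot x y.
Proof. by rewrite edotC edotNl (edotC x). Qed.

Definition edotE := (edotDl, edotDr, edotNl, edotNr, edotZl, edotZr).

Lemma edot_mulmx {m : nat} (A : 'M[R]_(m, n)) (w : 'cV[R]_m) x :
  edot (A^T *m w) x = edot w (A *m x).
Proof.
have edot_mx p (u v : 'cV[R]_p) : edot u v = (u^T *m v) 0 0.
  by rewrite mxE; apply: eq_bigr => i _; rewrite mxE.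
by rewrite !edot_mx trmx_mul trmxK mulmxA.
Qed.

Lemma edot_ge0 x : 0 <= edot x x.
Proof. by apply: sumr_ge0 => i _; rewrite -expr2 sqr_ge0. Qed.

Lemma edot_eq0 x : (edot x x == 0) = (x == 0).
Proof.
apply/eqP/eqP => [x0|->]; last by apply: big1 => i _; rewrite mxE mul0r.
apply/colP => i; rewrite mxE.
have /(psumr_eq0P _)/(_ i isT)/eqP := x0.
by rewrite mulf_eq0 orbb => x00; apply/eqP/x00 => j _; rewrite -expr2 sqr_ge0.
Qed.

Lemma enorm_ge0 x : 0 <= enorm x.
Proof. exact: sqrtr_ge0. Qed.

Lemma enorm_sqr x : enorm x ^+ 2 = edot x x.
Proof.
rewrite sqr_sqrtr; last by apply: sumr_ge0 => i _; rewrite sqr_ge0.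
by apply: eq_bigr => i _; rewrite expr2.
Qed.

Lemma ler_enorm x y :
  (enorm x <= enorm y) = (enorm x ^+ 2 <= enorm y ^+ 2).
Proof. by rewrite ler_sqr ?nnegrE ?enorm_ge0. Qed.

(** The topology is that of the max norm; this bound and the continuity of
    [enorm] below are all it takes to run convergence arguments in the
    Euclidean norm. *)
Lemma mx_norm_le_enorm x : `|x| <= enorm x.
Proof.
rewrite [leLHS]/Num.norm /= mx_normrE; apply/bigmax_leP; split=> [|[i j] _ /=].
  exact: enorm_ge0.
rewrite -sqrtr_sqr (ord1 j); apply: ler_wsqrtr.
rewrite (bigD1 i) //= lerDl; apply: sumr_ge0 => k _; exact: sqr_ge0.
Qed.

Lemma enorm_continuous : continuous (@enorm R n).
Proof.
move=> x; apply: continuous_comp; last exact: sqrt_continuous.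
apply: continuous_big; first exact: add_continuous.
move=> i _ y; apply: (@continuous_comp _ _ _
  (fun x : 'cV[R]_n => x i 0) (fun r : R => r ^+ 2)).
  exact: coord_continuous.
exact: exprn_continuous.
Qed.

Lemma enorm_dist_continuous x : continuous (fun y => enorm (x - y)).
Proof.
move=> y; apply: (@continuous_comp _ _ _ (fun y => x - y) (@enorm R n)).
  by apply: (@continuousB _ _ _ (fun=> x) id);
    [exact: cst_continuous|exact: cvg_id].
exact: enorm_continuous.
Qed.

Lemma cvg_enorm_sub {F : set_system 'cV[R]_n} {FF : Filter F} x :
  (forall e, 0 < e -> \forall y \near F, enorm (x - y) < e) -> F --> x.
Proof.
move=> h; apply/cvgrPdist_lt => e e0; near=> y.
by apply: le_lt_trans (mx_norm_le_enorm _) _; near: y; apply: h.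
Unshelve. all: by end_near. Qed.

Lemma enorm_sub_near x (e : R) : 0 < e ->
  \forall y \near x, enorm (x - y) < e.
Proof.
move=> e0.
have := @enorm_dist_continuous x x; rewrite /continuous_at.
have -> : enorm (x - x) = 0.
  by apply/eqP; rewrite -sqrf_eq0 enorm_sqr edot_eq0 subrr.
by move/cvgr_lt; apply.
Qed.

Lemma nonexpansive_continuous (T : 'cV[R]_n -> 'cV[R]_n) :
  (forall x y, enorm (T x - T y) <= enorm (x - y)) -> continuous T.
Proof.
move=> T1 /= x; have Tx_filter : Filter (T @ x).
  exact: (fmap_filter _ (nbhs_filter (x : 'cV[R]_n))).
apply: (@cvg_enorm_sub (T @ x) Tx_filter) => e e0.
have := enorm_sub_near x _ e0; apply: (@filterS _ (nbhs x) _).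
by move=> y; apply: le_lt_trans; exact: T1.
Qed.

(** A Euclidean ball is closed and lies in a box.  The product compactness
    theorem speaks of row vectors, hence the transposition. *)
Lemma enorm_ball_compact (c : 'cV[R]_n) (M : R) :
  compact [set x | enorm (c - x) <= M].
Proof.
have coordM x : enorm (c - x) <= M -> forall i, `|x i 0 - c i 0| <= M.
  move=> xM i; apply: le_trans xM; apply: le_trans (mx_norm_le_enorm _).
  rewrite distrC [leRHS]/Num.norm /= mx_normrE.
  by apply: (le_trans _ (le_bigmax _ _ (i, 0))); rewrite /= !mxE.
pose box := [set v : 'rV[R]_n | forall i, v 0 i \in `[c i 0 - M, c i 0 + M]].
have box_compact : compact box.
  by apply: (@rV_compact _ _ (fun i => `[c i 0 - M, c i 0 + M]%classic)) => i;
    apply: segment_compact.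
have trmx_cont : continuous (@trmx R 1 n).
  move=> /= u V /= /(nbhs_ballP u^T) [e e0 eV].
  apply/nbhs_ballP; exists e => //= v [_ uv]; apply: eV.
  by split=> // i j; rewrite !mxE; exact: uv.
have image_compact :=
  continuous_compact (continuous_subspaceT trmx_cont) box_compact.
apply: (subclosed_compact _ image_compact).
  have -> : [set x | enorm (c - x) <= M] =
      (fun x => enorm (c - x)) @^-1` [set r | r <= M] by [].
  apply: closed_comp; last exact: closed_le.
  by move=> x _; exact: enorm_dist_continuous.
move=> x /coordM xM; exists x^T; last exact: trmxK.
by move=> i /=; rewrite mxE in_itv /= -ler_distl.
Qed.

End InnerProduct.

(** * Projections onto closed convex sets *)

Section Projection.
Context {R : realType} {n : nat}.
Context (C : set 'cV[R]_n) (C_neq0 : C !=set0) (C_closed : closed C).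

(** Only the part of [C] in the ball through some [c0] of [C] competes, and it
    is compact. *)
Lemma eproj_nearest x : nearest_points C x (eproj C x).
Proof.
have [c0 Cc0] := C_neq0.
pose D := [set y | enorm (x - y) <= enorm (x - c0)] `&` C.
have D_compact : compact D.
  by apply: compact_closedI => //; exact: enorm_ball_compact.
have D_neq0 : D !=set0 by exists c0; split=> //=.
have [p] := compact_EVT_min D_neq0 D_compact
  (continuous_subspaceT (enorm_dist_continuous x)).
rewrite inE => -[/= p_le Cp] p_min.
apply: (@xgetPex _ 0); exists p; split=> // y Cy.
have [y_le|/ltW] := leP (enorm (x - y)) (enorm (x - c0)).
  by apply: p_min; rewrite inE.
exact: le_trans.
Qed.

Context (C_convex : convex_set C).

Lemma eproj_in x : C (eproj C x).
Proof. by have [] := eproj_nearest x. Qed.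

(** Moving from the projection [p] towards [y] by a fraction [t] stays in [C]
    and changes the squared distance to [x] by [- 2 t a + t^2 B], where [a] is
    the inner product at stake; if [a] were positive, a small [t] would do
    better than [p]. *)
Lemma eproj_obtuse x y : C y -> edot (x - eproj C x) (y - eproj C x) <= 0.
Proof.
have [Cp p_min] := eproj_nearest x; move: (eproj C x) Cp p_min => p Cp p_min Cy.
rewrite leNgt; apply/negP => a0.
set a := edot _ _ in a0.
have B0 : 0 <= edot (y - p) (y - p) by exact: edot_ge0.
set B := edot (y - p) _ in B0.
have aB0 : 0 < a + B by lra.
(* With this fraction, [2 a - t B = a + t a > 0]. *)
have t01 : 0 <= a / (a + B) <= 1.
  by apply/andP; split; [apply: divr_ge0; lra|rewrite ler_pdivrMr //; lra].
have := p_min (p + (a / (a + B)) *: (y - p)).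
set t := a / (a + B) in t01 *.
have tE : t * (a + B) = a by rewrite divfK ?gt_eqF.
have t0 : 0 < t by exact: divr_gt0.
rewrite ler_enorm opprD addrA => h.
have {h} : enorm (x - p) ^+ 2 <= enorm (x - p - t *: (y - p)) ^+ 2.
  apply: h.
  have /andP[t_ge0 t_le1] := t01.
  pose t' : {i01 R} := Itv01 t_ge0 t_le1.
  have convE : p + t *: (y - p) = t *: y + (1 - t) *: p.
    by rewrite scalerBr scalerBl scale1r addrCA.
  by rewrite convE; apply: set_mem; apply: (C_convex y p t'); exact: mem_set.
rewrite !enorm_sqr.
have -> : edot (x - p - t *: (y - p)) (x - p - t *: (y - p)) =
    edot (x - p) (x - p) - t * (2 * a - t * B).
  rewrite /a /B; move: (x - p) (y - p) => u v.
  by rewrite !edotE ?(edotC v u); ring.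
suff : 0 < t * (2 * a - t * B) by lra.
have ta0 := mulr_gt0 t0 a0; rewrite mulr_gt0 //; lra.
Qed.

(** The obtuse angle property at [p] and at [eproj C x], each tested against the
    other point, add up to [|eproj C x - p|^2 <= 0]. *)
Lemma eproj_unique x p :
  C p -> (forall y, C y -> edot (x - p) (y - p) <= 0) -> eproj C x = p.
Proof.
move=> Cp p_obtuse; apply/eqP; rewrite -subr_eq0 -edot_eq0 eq_le edot_ge0 andbT.
have := p_obtuse _ (eproj_in x); have := eproj_obtuse x p Cp.
move: (eproj C x) => q.
rewrite !edotE ?(edotC q x) ?(edotC p x) ?(edotC q p); lra.
Qed.

(** The obtuse angle properties at the two projections [p] and [q] give
    [|p - q|^2 <= <p - q, x - y>], which is what the claim says once
    [2 (p - q) - (x - y)] is expanded. *)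
Lemma ereflect_nonexpansive x y :
  enorm (ereflect C x - ereflect C y) <= enorm (x - y).
Proof.
have := eproj_obtuse x _ (eproj_in y); have := eproj_obtuse y _ (eproj_in x).
rewrite ler_enorm !enorm_sqr /ereflect; move: (eproj C x) (eproj C y) => p q.
rewrite !edotE ?(edotC y x) ?(edotC p x) ?(edotC q x)
  ?(edotC p y) ?(edotC q y) ?(edotC q p).
lra.
Qed.

Lemma eproj_nonexpansive x y : enorm (eproj C x - eproj C y) <= enorm (x - y).
Proof.
have := eproj_obtuse x _ (eproj_in y); have := eproj_obtuse y _ (eproj_in x).
have := edot_ge0 (x - y - (eproj C x - eproj C y)).
rewrite ler_enorm !enorm_sqr; move: (eproj C x) (eproj C y) => p q.
rewrite !edotE ?(edotC y x) ?(edotC p x) ?(edotC q x)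
  ?(edotC p y) ?(edotC q y) ?(edotC q p).
lra.
Qed.

End Projection.

(** * Firmly nonexpansive maps *)

Section FirmlyNonexpansive.
Context {R : realType} {n : nat}.
Implicit Types T N : 'cV[R]_n -> 'cV[R]_n.

Definition firmly_nonexpansive T := forall x y,
  enorm (T x - T y) ^+ 2 + enorm ((x - T x) - (y - T y)) ^+ 2 <=
  enorm (x - y) ^+ 2.

(** With [u = x - y] and [w = N x - N y], the two differences in the definition
    are [(u + w) / 2] and [(u - w) / 2], so the parallelogram law turns the sum
    of their squares into [(|u|^2 + |w|^2) / 2]. *)
Lemma firmly_nonexpansive_avg N c :
  (forall x y, enorm (N x - N y) <= enorm (x - y)) ->
  firmly_nonexpansive (fun x => 2%:R^-1 *: (x + N x) + c).
Proof.
move=> N1 x y; have := N1 x y; rewrite ler_enorm !enorm_sqr.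
move: (N x) (N y) => p q.
have -> : 2%:R^-1 *: (x + p) + c - (2%:R^-1 *: (y + q) + c) =
    2%:R^-1 *: ((x - y) + (p - q)).
  by rewrite opprD addrACA subrr addr0 -scalerBr opprD addrACA.
have -> : x - (2%:R^-1 *: (x + p) + c) - (y - (2%:R^-1 *: (y + q) + c)) =
    2%:R^-1 *: ((x - y) - (p - q)).
  by apply/matrixP => i j; rewrite !mxE; field.
move: (x - y) (p - q) => u v; rewrite !edotE ?(edotC v u); lra.
Qed.

Lemma firmly_nonexpansive_nonexpansive T x y : firmly_nonexpansive T ->
  enorm (T x - T y) <= enorm (x - y).
Proof.
move=> fT; rewrite ler_enorm; apply: le_trans (fT x y).
by rewrite lerDl sqr_ge0.
Qed.

Lemma firmly_nonexpansive_continuous T : firmly_nonexpansive T -> continuous T.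
Proof.
by move=> fT; apply: nonexpansive_continuous => x y;
  exact: firmly_nonexpansive_nonexpansive.
Qed.

End FirmlyNonexpansive.

(** * Orbits of firmly nonexpansive maps *)

Section Orbits.
Context {R : realType} {n : nat}.
Implicit Types p : 'cV[R]_n.
Context (T : 'cV[R]_n -> 'cV[R]_n) (z : nat -> 'cV[R]_n).
Context (z_step : forall k, z k.+1 = T (z k)).

Lemma cluster_frequently p (V : set 'cV[R]_n) N : cluster (z @ \oo) p ->
  nbhs p V -> exists2 k, (N <= k)%N & V (z k).
Proof.
move=> z_p pV; have z_N : (z @ \oo) (z @` [set k | (N <= k)%N]).
  by exists N => // k Nk; exists k.
by have [_ [[k Nk <-] Vk]] := z_p _ _ z_N pV; exists k.
Qed.

Lemma cluster_image p : continuous T -> cluster (z @ \oo) p ->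
  cluster (z @ \oo) (T p).
Proof.
move=> T_cont z_p A V [N _ AN] /T_cont Vp.
have [k Nk Vk] := cluster_frequently p _ N z_p Vp.
exists (z k.+1); split; first by apply: AN; exact: leqW.
by rewrite z_step.
Qed.

(** LaSalle's invariance principle: since [D] decreases along the orbit, a drop
    from [D p] to [D (T p)] would let the orbit, after a visit near [p], never
    again come close to [p]. *)
Lemma cluster_lyapunov (D : 'cV[R]_n -> R) p : continuous T -> continuous D ->
  (forall x, D (T x) <= D x) -> cluster (z @ \oo) p -> D (T p) = D p.
Proof.
move=> T_cont D_cont D_le z_p; apply/eqP; rewrite eq_le D_le leNgt.
apply/negP => DTp.
have D_mono j k : (j <= k)%N -> D (z k) <= D (z j).
  move=> /subnK <-; elim: (k - j)%N => // i; apply: le_trans.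
  by rewrite addSn z_step.
pose c := (D (T p) + D p) / 2.
have c_lt : D (T p) < c < D p by rewrite /c; lra.
have [/andP[c1 c2]] := c_lt.
have near_c1 : \forall y \near p, D (T y) < c.
  have DT : {for p, continuous (D \o T)}.
    by apply: continuous_comp; [exact: T_cont|exact: D_cont].
  by move/cvgr_lt: DT; apply.
have near_c2 : \forall y \near p, c < D y.
  by have /cvgr_gt := D_cont p; apply.
have [j _ zj] := cluster_frequently p _ 0%N z_p near_c1.
have [k jk zk] := cluster_frequently p _ j.+1 z_p near_c2.
by have := D_mono _ _ jk; rewrite z_step; lra.
Qed.

Context (T_fne : firmly_nonexpansive T).

Lemma orbit_enorm_le (y : nat -> 'cV[R]_n) k : (forall k, y k.+1 = T (y k)) ->
  enorm (z k - y k) <= enorm (z 0%N - y 0%N).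
Proof.
move=> y_step; elim: k => // k; apply: le_trans.
by rewrite z_step y_step; exact: firmly_nonexpansive_nonexpansive.
Qed.

(** Apply the invariance principle to the length of the displacement: in the
    firm nonexpansiveness inequality between [p] and [T p], this leaves no room
    for the displacement vector to change. *)
Lemma cluster_displacement p : cluster (z @ \oo) p -> T p - T (T p) = p - T p.
Proof.
move=> z_p; have T_cont := firmly_nonexpansive_continuous T T_fne.
have D_cont : continuous (fun x : 'cV[R]_n => enorm (x - T x)).
  move=> x; apply: (@continuous_comp _ _ _
    (fun x : 'cV[R]_n => x - T x) (@enorm R n)).
    by apply: (@continuousB _ _ _ id T); [exact: cvg_id|exact: T_cont].
  exact: enorm_continuous.
have D_le x : enorm (T x - T (T x)) <= enorm (x - T x).
  exact: firmly_nonexpansive_nonexpansive.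
have D_eq := cluster_lyapunov _ p T_cont D_cont D_le z_p.
have := T_fne p (T p); rewrite /= in D_eq; rewrite D_eq gerDl enorm_sqr => le0.
apply/esym/eqP; rewrite -subr_eq0 -edot_eq0 eq_le edot_ge0 andbT.
exact: le0.
Qed.

(** By [cluster_displacement] the orbit of [p] is the arithmetic progression
    [p - k v].  It stays at bounded distance from [z k], which is close to [p]
    for arbitrarily large [k], so [k |v|] is bounded and [v] vanishes. *)
Lemma cluster_fixed p : cluster (z @ \oo) p -> T p = p.
Proof.
move=> z_p; have T_cont := firmly_nonexpansive_continuous T T_fne.
pose v := p - T p.
have orbit_p k : iter k T p = p - k%:R *: v /\ cluster (z @ \oo) (iter k T p) /\
    iter k T p - T (iter k T p) = v.
  elim: k => [|k [IH [IHc IHv]]] /=; first by rewrite scale0r subr0.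
  split; last first.
    split; first exact: cluster_image.
    by rewrite cluster_displacement.
  by rewrite -natr1 scalerDl scale1r opprD addrA -IH -IHv subKr.
have v0 : edot v v = 0.
  apply/eqP; rewrite eq_le edot_ge0 andbT leNgt; apply/negP => v_gt0.
  (* [|k v|^2 <= 2 |p - z k|^2 + 2 |k v - (p - z k)|^2 <= B] when [z k] is
     within distance 1 of [p]. *)
  pose B := 2 + 2 * enorm (z 0%N - p) ^+ 2.
  have [k Nk zk] := cluster_frequently p _ (Num.truncn (B / edot v v)).+1 z_p
    (enorm_sub_near p 1 ltr01).
  have := orbit_enorm_le (fun k => iter k T p) k (fun _ => erefl).
  have [-> _] := orbit_p k; rewrite /= ler_enorm.
  have kB : B < k%:R * edot v v.
    rewrite -ltr_pdivrMr //; apply: lt_le_trans (truncnS_gt _) _.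
    by rewrite ler_nat.
  have k1 : 1 <= k%:R :> R by rewrite ler1n; exact: leq_trans Nk.
  have zk2 : enorm (p - z k) ^+ 2 < 1 by rewrite expr_lt1 ?enorm_ge0.
  (* [2 u - k v] is the difference of [u = p - z k] and [k v - u], whose sum
     is [k v]: the parallelogram law bounds [|k v|^2]. *)
  have := edot_ge0 (2%:R *: (p - z k) + - (k%:R *: v)).
  move: kB zk2; rewrite /B (enorm_sqr (p - z k)) (enorm_sqr (z k - _)).
  have -> : z k - (p - k%:R *: v) = k%:R *: v - (p - z k).
    by rewrite !opprB addrC addrA addrAC -addrA addrC.
  move: (p - z k) => u; rewrite !edotE ?(edotC v u).
  nra.
by apply/esym/eqP; rewrite -subr_eq0 -edot_eq0 v0.
Qed.

(** Distances to the fixed point [p] do not increase, so one visit close to [p]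
    keeps all later iterates close. *)
Lemma cluster_cvg p : cluster (z @ \oo) p -> z k @[k --> \oo] --> p.
Proof.
move=> z_p; have Tp := cluster_fixed p z_p.
apply: cvg_enorm_sub => e e0.
have [j _ zj] := cluster_frequently p _ 0%N z_p (enorm_sub_near p e e0).
exists j => // k /= /subnK <-; elim: (k - j)%N => // i; apply: le_lt_trans.
rewrite addSn z_step -[in leLHS]Tp.
exact: firmly_nonexpansive_nonexpansive.
Qed.

(** If the norm does not tend to infinity, infinitely many iterates lie in one
    ball; compactness of that ball gives a cluster point. *)
Lemma orbit_cvg_or_dvg : (exists2 p, T p = p & z k @[k --> \oo] --> p) \/
  enorm (z k) @[k --> \oo] --> +oo.
Proof.
have [|z_dvg] := pselect (enorm (z k) @[k --> \oo] --> +oo); [by right|left].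
have [M zM] : exists M, forall N, exists2 k, (N <= k)%N & enorm (z k) <= M.
  apply: contrapT => /forallNP zM; apply: z_dvg; apply/cvgryPgt => M.
  have /existsNP[N zN] := zM M; exists N => // k /= Nk.
  by rewrite ltNge; apply/negP => zk; apply: zN; exists k.
pose F := within [set k | enorm (z k) <= M] \oo.
have F_proper : ProperFilter F.
  apply: Build_ProperFilter_ex => P [N _ NP].
  by have [k Nk zk] := zM N; exists k; exact: NP.
have zF : (z @ F) [set x | enorm (0 - x) <= M].
  exists 0%N => // k _ /=; rewrite sub0r; congr (Num.sqrt _ <= _).
  by apply: eq_bigr => i _; rewrite mxE sqrrN.
have [p [_ zFp]] :=
  enorm_ball_compact 0 M (z @ F) (fmap_proper_filter _ F_proper) zF.
have z_p : cluster (z @ \oo) p.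
  by apply: cvg_cluster zFp; apply: cvg_app; exact: cvg_within.
by exists p; [exact: cluster_fixed|exact: cluster_cvg].
Qed.

Lemma fixed_not_dvg p : T p = p -> ~ enorm (z k) @[k --> \oo] --> +oo.
Proof.
move=> Tp /cvgryPgt z_dvg.
pose M := 1 + 2 * enorm (z 0%N - p) ^+ 2 + 2 * enorm p ^+ 2.
have [k _ /(_ k (leqnn k)) /= zk] := z_dvg M.
have := orbit_enorm_le (fun=> p) k (fun=> esym Tp); rewrite ler_enorm /= => zkp.
(* Parallelogram law for [z k - p] and [p], whose sum is [z k]. *)
have := edot_ge0 (z k - p - p).
have -> : edot (z k - p - p) (z k - p - p) =
    2 * enorm (z k - p) ^+ 2 + 2 * enorm p ^+ 2 - enorm (z k) ^+ 2.
  by rewrite !enorm_sqr !edotE ?(edotC p (z k)); ring.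
have M1 : 1 <= M by rewrite /M; have := sqr_ge0 (enorm p);
  have := sqr_ge0 (enorm (z 0%N - p)); lra.
have : M < enorm (z k) ^+ 2 by nra.
by rewrite {1}/M; lra.
Qed.

End Orbits.

(** * Fixed points of the iteration and feasible points *)

Section FixedPoints.
Context {R : realType} {m n : nat}.
Context (K : set 'cV[R]_n) (A : 'M[R]_(m, n)) (b : 'cV[R]_m).
Context (K_neq0 : K !=set0) (K_closed : closed K) (K_convex : convex_set K).

Lemma null_space_neq0 : null_space A !=set0.
Proof. by exists 0; rewrite /null_space /= mulmx0. Qed.

Lemma null_space_closed : closed (null_space A).
Proof.
have -> : null_space A =
    \bigcap_(i in [set: 'I_m]) (fun x : 'cV[R]_n => (A *m x) i 0) @^-1` [set 0].
  apply/seteqP; split=> [x Ax i _ /=|x Ax]; first by rewrite Ax mxE.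
  by apply/colP => i; rewrite Ax // mxE.
apply: closed_bigI => i _; apply: closed_comp => [x _|]; last exact: closed_eq.
have -> : (fun x : 'cV[R]_n => (A *m x) i 0) =
    (fun x => \sum_j A i j * x j 0) by apply/funext => y; rewrite mxE.
apply: continuous_big; first exact: add_continuous.
move=> j _ y; apply: continuousM; first exact: cst_continuous.
exact: coord_continuous.
Qed.

Lemma null_space_convex : convex_set (null_space A).
Proof.
move=> x y t /set_mem Ax /set_mem Ay; apply: mem_set; rewrite /null_space /=.
by rewrite /conv /= mulmxDr -!scalemxAr Ax Ay !scaler0 addr0.
Qed.

Context (le_mn : (m <= n)%N) (A_full_rank : \rank A = minn m n).

(** Full row rank makes the Gram matrix [A A^T] invertible: [w A A^T = 0]
    implies [|w A|^2 = 0]. *)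
Lemma mulmx_offset : A *m offset A b = b.
Proof.
rewrite /offset !mulmxA mulmxV ?mul1mx // -row_free_unit.
have A_free : row_free A by rewrite /row_free A_full_rank; apply/eqP/minn_idPl.
apply: inj_row_free => w wAA; apply/eqP; rewrite -(mulmx_free_eq0 _ A_free).
rewrite -trmx_eq0 -edot_eq0 trmx_mul edot_mulmx.
have -> : A *m (A^T *m w^T) = (w *m (A *m A^T))^T.
  by rewrite !trmx_mul trmxK mulmxA.
by rewrite wAA trmx0 -(scale0r 0) edotZr mul0r.
Qed.

(** The offset lies in the range of [A^T], hence is orthogonal to the null
    space. *)
Lemma eproj_null_space x : A *m x = b ->
  eproj (null_space A) x = x - offset A b.
Proof.
move=> Ax; apply: eproj_unique; [exact: null_space_neq0|exact: null_space_closed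
  |exact: null_space_convex| |].
  by rewrite /null_space /= mulmxBr Ax mulmx_offset subrr.
move=> y Ay; rewrite subKr {1}/offset -mulmxA edot_mulmx.
rewrite mulmxBr Ay mulmxBr Ax mulmx_offset !subrr.
by rewrite -(scale0r 0) edotZr mul0r.
Qed.

Lemma T2_firmly_nonexpansive : firmly_nonexpansive (T2 A b K).
Proof.
apply: firmly_nonexpansive_avg => x y.
apply: le_trans (ereflect_nonexpansive _ null_space_neq0 null_space_closed
  null_space_convex _ _) _.
exact: ereflect_nonexpansive.
Qed.

Lemma T2E z : T2 A b K z =
  z - eproj K z + (eproj (null_space A) (ereflect K z) + offset A b).
Proof.
rewrite /T2 /Ttilde [RHS]addrA; congr (_ + _); rewrite /ereflect.
move: (eproj K z) (eproj _ _) => p q.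
by apply/colP => i; rewrite !mxE; field.
Qed.

(** At a fixed point, [P_K z] equals [P_N (R_K z) + x0], and [A] maps this to
    [0 + b]. *)
Lemma T2_fixed_feasible z : T2 A b K z = z -> feasible_set A b K (eproj K z).
Proof.
rewrite T2E => Tz; split; first exact: eproj_in.
have {Tz} -> : eproj K z = eproj (null_space A) (ereflect K z) + offset A b.
  apply: (@addrI _ (z - eproj K z)); rewrite Tz subrK //.
rewrite /= mulmxDr mulmx_offset.
have -> := eproj_in _ null_space_neq0 null_space_closed (ereflect K z).
by rewrite add0r.
Qed.

(** For feasible [x], [P_K x = x], so [R_K x = x] as well, and
    [P_N x = x - x0]. *)
Lemma feasible_T2_fixed x : feasible_set A b K x -> T2 A b K x = x.
Proof.
move=> [Kx Ax]; have Px : eproj K x = x.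
  apply: eproj_unique => // y _; rewrite subrr.
  by rewrite -(scale0r 0) edotZl mul0r.
rewrite T2E /ereflect Px subrr add0r scaler_nat mulr2n addrK.
by rewrite eproj_null_space // subrK.
Qed.

End FixedPoints.

Theorem theorem5 (R : realType) (m n : nat) (K : set 'cV[R]_n)
    (A : 'M[R]_(m, n)) (b : 'cV[R]_m) (z0 : 'cV[R]_n) (z : nat -> 'cV[R]_n)
    (K_neq0 : K !=set0) (K_closed : closed K) (K_convex : convex_set K)
    (K_cone : is_cone K)
    (le_mn : (m <= n)%N) (A_full_rank : \rank A = minn m n)
    (z_init : z 0%N = z0)
    (z_step : forall k : nat, z k.+1 = T2 A b K (z k)) :
  ((feasible A b K <-> exists l : 'cV[R]_n, z k @[k --> \oo] --> l)
   /\ (feasible A b K ->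
       exists xs : 'cV[R]_n,
         feasible_set A b K xs /\ eproj K (z k) @[k --> \oo] --> xs))
  /\ (~ feasible A b K <-> enorm (z k) @[k --> \oo] --> +oo).
Proof.
have T_fne : firmly_nonexpansive (T2 A b K) by apply: T2_firmly_nonexpansive.
have fixed_cvg l : z k @[k --> \oo] --> l -> T2 A b K l = l.
  move=> z_l; apply: (cluster_fixed _ z) => //.
  by move=> U V zU /z_l zV; exact: (@filter_ex _ (z @ \oo) _ _ (filterI zU zV)).
have fixed_feasible l : T2 A b K l = l -> feasible A b K.
  by move=> Tl; exists (eproj K l); exact: T2_fixed_feasible.
have feasible_bounded : feasible A b K -> ~ enorm (z k) @[k --> \oo] --> +oo.
  move=> [x Fx]; apply: (fixed_not_dvg _ _ z_step T_fne x);
  exact: feasible_T2_fixed.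
have feasible_cvg : feasible A b K ->
    exists2 l, T2 A b K l = l & z k @[k --> \oo] --> l.
  move=> /feasible_bounded z_bounded.
  by have [|/z_bounded] := orbit_cvg_or_dvg _ _ z_step T_fne.
split; [split; [split|]|split].
- by move=> /feasible_cvg[l _ z_l]; exists l.
- by move=> [l /fixed_cvg]; exact: fixed_feasible.
- move=> /feasible_cvg[l Tl z_l]; exists (eproj K l).
  split; first exact: T2_fixed_feasible.
  apply: continuous_cvg z_l.
  apply: nonexpansive_continuous; exact: eproj_nonexpansive.
- move=> infeasible; have [[l Tl _]|//] := orbit_cvg_or_dvg _ _ z_step T_fne.
  by case: infeasible; exact: fixed_feasible Tl.
- by move=> z_dvg /feasible_bounded.
Qed.
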